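(* Let $n$ and $m$ be positive even integers and let $\mathcal C$ be a cyclic subgroup of $C_n\times C_m\subset SO(2)\times SO(2)$ which contains the element $(-I,-I)$. Then $\mathcal C$ can be written as $$\mathcal C=\left\{\left(R\left(\left(\tfrac{2\pi}{n}\mathcal A\right)i\right),R\left(\left(\tfrac{2\pi}{m}\mathcal B\right)i\right)\right):\ i\in\mathbb Z\right\},$$ where $$\mathcal A=\sum_{i=1}^{\nu}r_ip_i^{a_i-k_i}\frac{n}{p_i^{a_i}}+\sum_{i=\nu+1}^{\nu+\chi}p_i^{a_i-k_i}\frac{n}{p_i^{a_i}}+\sum_{i=\nu+\chi+1}^{\nu+\chi+\tau}j_i\frac{n}{p_i^{a_i}}+\sum_{i=\nu+\chi+\tau+1}^{\nu+\chi+\tau+\psi}p_i^{a_i-k_i}\frac{n}{p_i^{a_i}},$$ $$\mathcal B=\sum_{i=1}^{\nu}p_i^{b_i-k_i}\frac{m}{p_i^{b_i}}+\sum_{i=\nu+1}^{\nu+\chi}\rho_ip_i^{b_i-k_i+1}\frac{m}{p_i^{b_i}}+\sum_{i=\nu+\chi+1}^{\nu+\chi+\tau}p_i^{b_i-k_i}\frac{m}{p_i^{b_i}}+\sum_{i=\nu+\chi+\tau+1}^{\nu+\chi+\tau+\psi}j_i\frac{m}{p_i^{b_i}},$$ for some values of the parameters in the ranges specified in the context.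
   Context: $R(\theta)=\begin{pmatrix}\cos\theta&\sin\theta\\-\sin\theta&\cos\theta\end{pmatrix}$; $C_N=\{R(2\pi r/N):0\le r\le N-1\}\subset SO(2)$. Parameters: write $n=2^{\alpha_1}\mathrm p_2^{\alpha_2}\cdots\mathrm p_s^{\alpha_s}$, $m=2^{\beta_1}\mathrm p_2^{\beta_2}\cdots\mathrm p_s^{\beta_s}$ with $\mathrm p_1=2$, $\mathrm p_2,\dots,\mathrm p_s$ distinct odd primes, $\alpha_1,\beta_1\ge1$, $\alpha_i,\beta_i\ge0$ for $i\ge2$. The ranges are: - $\nu,\chi,\tau,\psi$ are non-negative integers with $\nu+\chi+\tau+\psi\le s$, and $(p_i^{a_i},p_i^{b_i})$, $i=1,\dots,s$, is a permutation of the $s$ pairs $(\mathrm p_i^{\alpha_i},\mathrm p_i^{\beta_i})$; - one of the primes $p_1,\dots,p_\nu$ is $2$; if $p_t=2$, then $1\le k_t\le\min(a_t,b_t)$ and $r_t\in\{1,\dots,2^{k_t}-1\}\setminus\{2,2\cdot2,\dots,(2^{k_t-1}-1)2\}$; - for $i\in\{1,\dots,\nu\}\setminus\{t\}$: $k_i\le\min(a_i,b_i)$ and $r_i\in\{0,1,\dots,p_i^{k_i}-1\}$; - for $\nu<i\le\nu+\chi$: $1\le k_i\le\min(a_i,b_i)$ and $\rho_i\in\{0,1,\dots,p_i^{k_i-1}-1\}$; - for $\nu+\chi<i\le\nu+\chi+\tau$: $a_i<k_i\le b_i$ and $j_i\in\{0,1,\dots,p_i^{a_i}-1\}$; - for $\nu+\chi+\tau<i\le\nu+\chi+\tau+\psi$: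 $b_i<k_i\le a_i$ and $j_i\in\{0,1,\dots,p_i^{b_i}-1\}$. The $k_i$ are non-negative integers; some or all of the exponents $a_i,b_i$ with $i\neq t$ may be zero; empty sums are $0$. *)

(* Defs.v *)
From mathcomp Require Import all_boot all_order all_algebra perm.
From mathcomp Require Import all_classical all_reals all_analysis.

Set Implicit Arguments.
Unset Strict Implicit.
Unset Printing Implicit Defensive.

Import Order.TTheory GRing.Theory Num.Theory.

Local Open Scope classical_set_scope.
Local Open Scope ring_scope.

(* The matrix with rows (cos t, sin t) and (- sin t, cos t). *)
Definition rotation_mx (R : realType) (t : R) : 'M[R]_2 :=
  \matrix_(i, j) if i == j then cos t
                 else if i == 0 then sin t else - sin t.

Definition rotation_group (R : realType) (N : nat) : set 'M[R]_2 :=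
  [set rotation_mx (2 * pi * r%:R / N%:R) | r in [set r : nat | (r < N)%N]].

(* G is meant to be a group of units of T.  The group SO(2) x SO(2) lives in
   the product ring 'M[R]_2 * 'M[R]_2, whose multiplication and inverse (on
   units) are componentwise. *)
Definition is_subgroup (T : unitRingType) (H G : set T) : Prop :=
  [/\ H `<=` G, H 1,
      forall x y, H x -> H y -> H (x * y) &
      forall x, H x -> H x^-1].

(* [g ^ z] is the integer power. *)
Definition is_cyclic (T : unitRingType) (H : set T) : Prop :=
  exists2 g : T, H g & H = [set g ^ z | z in [set: int]].

(* Index i : 'I_s stands for the (i+1)-st prime, so the first prime, 2, has
   index [Ordinal hs].  Exponents at the other indices may vanish in n, in m,
   or in both. *)
Definition common_factorization (n m s : nat) (hs : (0 < s)%N)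
    (q alpha beta : 'I_s -> nat) : Prop :=
  [/\ q (Ordinal hs) = 2%N,
      (forall i, i != Ordinal hs -> prime (q i) /\ odd (q i)) /\ injective q,
      (0 < alpha (Ordinal hs))%N /\ (0 < beta (Ordinal hs))%N,
      n = (\prod_(i < s) q i ^ alpha i)%N &
      m = (\prod_(i < s) q i ^ beta i)%N].

Local Open Scope nat_scope.

(* Indices start at 0: the four blocks, of lengths nu, chi, tau and psi, are
   consecutive and start at index 0.  The values of k, r, rho and j outside the
   blocks mentioning them are irrelevant. *)
Definition param_ranges (s : nat) (p a b : 'I_s -> nat)
    (nu chi tau psi : nat) (k r rho j : 'I_s -> nat) : Prop :=
  [/\ nu + chi + tau + psi <= s,
      exists t : 'I_s,
        [/\ t < nu, p t = 2,
            1 <= k t <= minn (a t) (b t),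
            1 <= r t <= 2 ^ k t - 1
              /\ ~ (exists2 l, 1 <= l <= 2 ^ (k t - 1) - 1 & r t = l * 2) &
            forall i : 'I_s, i < nu -> i != t ->
              k i <= minn (a i) (b i) /\ r i <= p i ^ k i - 1],
      forall i : 'I_s, nu <= i < nu + chi ->
        1 <= k i <= minn (a i) (b i) /\ rho i <= p i ^ (k i - 1) - 1,
      forall i : 'I_s, nu + chi <= i < nu + chi + tau ->
        a i < k i <= b i /\ j i <= p i ^ a i - 1 &
      forall i : 'I_s, nu + chi + tau <= i < nu + chi + tau + psi ->
        b i < k i <= a i /\ j i <= p i ^ b i - 1].

(* Under [param_ranges], and when n and m have p-adic exponents a and b, every
   natural-number subtraction and division below is exact. *)
Definition cyclicA (s : nat) (p a : 'I_s -> nat) (nu chi tau psi : nat)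
    (k r j : 'I_s -> nat) (n : nat) : nat :=
  \sum_(i < s | i < nu) r i * p i ^ (a i - k i) * (n %/ p i ^ a i)
  + \sum_(i < s | nu <= i < nu + chi) p i ^ (a i - k i) * (n %/ p i ^ a i)
  + \sum_(i < s | nu + chi <= i < nu + chi + tau) j i * (n %/ p i ^ a i)
  + \sum_(i < s | nu + chi + tau <= i < nu + chi + tau + psi)
      p i ^ (a i - k i) * (n %/ p i ^ a i).

Definition cyclicB (s : nat) (p b : 'I_s -> nat) (nu chi tau psi : nat)
    (k rho j : 'I_s -> nat) (m : nat) : nat :=
  \sum_(i < s | i < nu) p i ^ (b i - k i) * (m %/ p i ^ b i)
  + \sum_(i < s | nu <= i < nu + chi)
      rho i * p i ^ (b i - k i + 1) * (m %/ p i ^ b i)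
  + \sum_(i < s | nu + chi <= i < nu + chi + tau)
      p i ^ (b i - k i) * (m %/ p i ^ b i)
  + \sum_(i < s | nu + chi + tau <= i < nu + chi + tau + psi)
      j i * (m %/ p i ^ b i).

(* Main.v *)
Require Import Defs.
From mathcomp Require Import all_boot all_order all_algebra perm.
From mathcomp Require Import all_classical all_reals all_analysis.
From mathcomp Require Import zify ring lra.

Set Implicit Arguments.
Unset Strict Implicit.
Unset Printing Implicit Defensive.

Import Order.TTheory GRing.Theory Num.Theory.

Local Open Scope nat_scope.

(** Rotations turn the statement into one about Z/n x Z/m.  Writing [turn n w]
    for the rotation by w n-ths of a full turn, [turn n] is a homomorphism from
    the integers whose kernel is nZ ([turn_eq1]), so a generator of C is a pair
    (turn n x, turn m y), and C depends only on the cyclic subgroup generated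
    by (x, y) in Z/n x Z/m.  This subgroup does not change when (x, y) is
    multiplied by a unit u of Z/nm ([same_multiples]).  The theorem thus says
    that some unit multiple of (x, y) is congruent to (A, B).

    By the Chinese remainder theorem the unit can be chosen prime by prime, and
    at a prime p with exponents a and b there remain the unit multiples of a
    pair (x, y) in Z/p^a x Z/p^b.  Let p^kx and p^ky be the orders of x and y.
    The entry of larger order p^k can be scaled to the exact power p^(a-k) or
    p^(b-k); of the other entry only a bound on its order remains.
    The four blocks of the statement are the four cases: y has the larger order
    (ties included) and k <= a, or k > a; x has strictly larger order and
    k <= b, or k > b ([local_normal_form]).  A permutation sorting the primes by
    case makes the blocks consecutive ([block_decomposition]).

    The element (-I, -I) matters at the prime 2 only.  Some multiple z(x, y) has
    both components of order 2, in Z/n and in Z/m, hence also in Z/2^a and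
    Z/2^b.  So x and y have the same 2-power order 2^k with k >= 1, and in the
    normal form (r 2^(a-k), 2^(b-k)) the factor r is odd ([order2_ranges]). *)

(** * Pairs of residues modulo powers of one prime *)

(** The constraints on the parameters of a single prime; c = 0, 1, 2, 3 tells
    which of the blocks, of lengths nu, chi, tau and psi, contains the prime. *)
Definition local_ranges (p a b c k r rho j : nat) : Prop :=
  match c with
  | 0 => k <= minn a b /\ r <= p ^ k - 1
  | 1 => 1 <= k <= minn a b /\ rho <= p ^ (k - 1) - 1
  | 2 => a < k <= b /\ j <= p ^ a - 1
  | 3 => b < k <= a /\ j <= p ^ b - 1
  | _ => False
  end.

(** The factor in front of n / p^a (here) and m / p^b (below) in the term that
    a prime of class c contributes to the two sums. *)
Definition local_coefA (p a c k r j : nat) : nat :=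
  match c with
  | 0 => r * p ^ (a - k)
  | 2 => j
  | _ => p ^ (a - k)
  end.

Definition local_coefB (p b c k rho j : nat) : nat :=
  match c with
  | 1 => rho * p ^ (b - k + 1)
  | 3 => j
  | _ => p ^ (b - k)
  end.

Lemma coprime_inverse (d u : nat) : 0 < d -> coprime u d ->
  exists2 v, coprime v d & u * v = 1 %[mod d].
Proof.
move=> d_gt0; case: (posnP u) => [-> | u_gt0] cud.
  have -> : d = 1 by move: cud; rewrite /coprime gcd0n => /eqP.
  by exists 1; rewrite ?modn1.
have [v w e _] := egcdnP d u_gt0.
exists v; last by rewrite mulnC e (eqP cud) modnMDl.
have: coprime (v * u) d by rewrite e (eqP cud) /coprime gcdnC gcdnMDl gcdn1.
by rewrite coprimeMl => /andP[].
Qed.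

(** Elements of Z/p^b are powers of p up to units.  The index k is the one for
    which p^k is the order of y, so that k = 0 exactly when p^b divides y. *)
Lemma power_up_to_unit (p b y : nat) : prime p ->
  exists u k, [/\ coprime u p, k <= b, p ^ (b - k) %| y
                & u * y = p ^ (b - k) %[mod p ^ b]].
Proof.
move=> pr_p; have p_gt0 := prime_gt0 pr_p.
have [pby | npby] := boolP (p ^ b %| y).
  exists 1, 0; rewrite coprime1n subn0; split=> //.
  by rewrite mul1n modnn; apply/eqP.
have y_gt0 : 0 < y by rewrite lt0n; apply: contraNneq npby => ->.
have ltb : logn p y < b by rewrite ltnNge -pfactor_dvdn.
have [w cpw y_def] := pfactor_coprime pr_p y_gt0.
have [||u cu uw] := @coprime_inverse (p ^ b) w _ _.
- by rewrite expn_gt0 p_gt0.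
- by rewrite coprimeXr // coprime_sym.
exists u, (b - logn p y); rewrite leq_subr subKn ?(ltnW ltb) //; split=> //.
- by rewrite coprime_pexpr // in cu; apply: leq_ltn_trans ltb.
- by rewrite pfactor_dvdn.
- by rewrite y_def mulnA [u * w]mulnC -modnMml uw modnMml mul1n -y_def.
Qed.

(** Lets the free parameter of each class be taken in the required range. *)
Lemma reduced_multiple (p c d w : nat) : 0 < p -> p ^ c %| w ->
  exists2 r, r <= p ^ d - 1 & r * p ^ c = w %[mod p ^ (d + c)].
Proof.
move=> p_gt0 /dvdnP[v ->]; exists (v %% p ^ d).
  by rewrite subn1 -ltnS prednK ?expn_gt0 ?p_gt0 // ltn_pmod ?expn_gt0 ?p_gt0.
by rewrite expnD -!muln_modl modn_mod.
Qed.

(** The unit is the one normalizing the entry of larger order; ties go to y,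
    which is why class 1 has the extra factor p in its second entry: there the
    order of y is at most p^(k-1). *)
Lemma local_normal_form_core (p a b x y : nat) : prime p ->
  exists u c k r rho j,
    [/\ coprime u p, local_ranges p a b c k r rho j,
        local_coefA p a c k r j = u * x %[mod p ^ a]
      & local_coefB p b c k rho j = u * y %[mod p ^ b]].
Proof.
move=> pr_p; have p_gt0 := prime_gt0 pr_p.
have [u [kx [cu le_kx dx ux]]] := power_up_to_unit a x pr_p.
have [v [ky [cv le_ky dy vy]]] := power_up_to_unit b y pr_p.
have dvd_scale w z i l : i <= l -> p ^ l %| z -> p ^ i %| w * z.
  by move=> le_il /(dvdn_trans (dvdn_exp2l p le_il)); exact: dvdn_mull.
have [le_xy | lt_yx] := leqP kx ky.
- have [le_ya | lt_ay] := leqP ky a.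
  + have dvx := dvd_scale v x (a - ky) _ (leq_sub2l a le_xy) dx.
    have [r ltr er] := reduced_multiple ky p_gt0 dvx.
    exists v, 0, ky, r, 0, 0; split=> //=.
      by rewrite leq_min le_ya.
    by move: er; rewrite subnKC.
  + have [j ltj ej] := reduced_multiple a p_gt0 (dvd1n (v * x) : p ^ 0 %| _).
    exists v, 2, ky, 0, 0, j; split=> //=; first by rewrite lt_ay.
    by move: ej; rewrite muln1 addn0.
have [le_xb | lt_bx] := leqP kx b.
- have le_sub : b - kx + 1 <= b - ky.
    by rewrite addn1 ltn_sub2l // (leq_trans lt_yx).
  have duy := dvd_scale u y _ _ le_sub dy.
  have [rho ltr er] := reduced_multiple (kx - 1) p_gt0 duy.
  exists u, 1, kx, 0, rho, 0; split=> //=.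
    by rewrite leq_min le_kx le_xb (leq_ltn_trans _ lt_yx).
  move: er; rewrite [b - kx + 1]addnC addnA subnK ?subnKC //.
  exact: leq_ltn_trans lt_yx.
have [j ltj ej] := reduced_multiple b p_gt0 (dvd1n (u * y) : p ^ 0 %| _).
exists u, 3, kx, 0, 0, j; split=> //=; first by rewrite lt_bx.
by move: ej; rewrite muln1 addn0.
Qed.

(** The sums A and B see the local coefficients through the cofactors
    e = n / p^a and f = m / p^b, which are units modulo p, so they are absorbed
    in x and y before normalizing. *)
Lemma local_normal_form (p a b e f x y : nat) :
  prime p -> coprime e p -> coprime f p ->
  exists u c k r rho j,
    [/\ coprime u p, local_ranges p a b c k r rho j,
        local_coefA p a c k r j * e = u * x %[mod p ^ a]
      & local_coefB p b c k rho j * f = u * y %[mod p ^ b]].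
Proof.
move=> pr_p ce cf; have p_gt0 := prime_gt0 pr_p.
have inv d w : coprime w p -> exists v, w * v = 1 %[mod p ^ d].
  move=> cw; have [||v _ ?] := @coprime_inverse (p ^ d) w; last by exists v.
    by rewrite expn_gt0 p_gt0.
  by rewrite coprimeXr.
have [[e' ee'] [f' ff']] := (inv a e ce, inv b f cf).
have [u [c [k [r [rho [j [cu rg eA eB]]]]]]] :=
  local_normal_form_core a b (e' * x) (f' * y) pr_p.
exists u, c, k, r, rho, j; split=> //.
- rewrite -modnMml eA modnMml.
  by rewrite [u * _]mulnCA mulnC mulnA -modnMml ee' modnMml mul1n.
- rewrite -modnMml eB modnMml.
  by rewrite [u * _]mulnCA mulnC mulnA -modnMml ff' modnMml mul1n.
Qed.

(** * Elements of order two *)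

(** The class of w has order exactly 2 in Z/d. *)
Definition of_order2 (d w : nat) : bool := (d %| 2 * w) && ~~ (d %| w).

Lemma of_order2_unit (d w u : nat) : coprime u d ->
  of_order2 d (w * u) = of_order2 d w.
Proof.
by rewrite coprime_sym => cdu; rewrite /of_order2 mulnA !(Gauss_dvdl _ cdu).
Qed.

Lemma of_order2_mod (d z w w' : nat) : w = w' %[mod d] ->
  of_order2 d (z * w) = of_order2 d (z * w').
Proof.
move=> ew; have dvdE v : (d %| v * w) = (d %| v * w').
  by rewrite /dvdn -modnMmr ew modnMmr.
by rewrite /of_order2 !mulnA !dvdE.
Qed.

(** An element killed by 2 is trivial in the odd factor Z/e, so its order is
    seen in Z/d. *)
Lemma of_order2_factor (d e w : nat) : coprime d e -> odd e ->
  of_order2 (d * e) w -> of_order2 d w.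
Proof.
move=> cde odd_e; rewrite /of_order2 !Gauss_dvd // => /andP[/andP[-> de] /=].
apply: contraNN => ->; move: de; rewrite Gauss_dvdr //.
by rewrite coprimen2.
Qed.

(** In each class one entry is an exact power 2^(d-k), and z times it having
    order 2 forces 2^(k-1) to divide z.  In classes 1, 2, 3, and in class 0 with
    r even, the other entry has order at most 2^(k-1), so z kills it; in class 0
    with k = 0 the second entry itself vanishes. *)
Lemma order2_ranges (a b c k r rho j z : nat) :
  local_ranges 2 a b c k r rho j ->
  of_order2 (2 ^ a) (z * local_coefA 2 a c k r j) ->
  of_order2 (2 ^ b) (z * local_coefB 2 b c k rho j) ->
  [/\ c = 0, 0 < k & odd r].
Proof.
have key d l : l <= d -> 2 ^ d %| 2 * (z * 2 ^ (d - l)) -> 2 ^ (l - 1) %| z.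
  move=> le_ld; case: l le_ld => [|l] le_ld; first by rewrite dvd1n.
  rewrite -{1}(subnKC le_ld) mulnA expnD dvdn_pmul2r ?expn_gt0 // expnS.
  by rewrite dvdn_pmul2l // subn1.
have big d i l w : 2 ^ i %| z -> 2 ^ l %| w -> d <= i + l -> 2 ^ d %| z * w.
  move=> dz dw le_d; apply: dvdn_trans (dvdn_exp2l 2 le_d) _.
  by rewrite expnD dvdn_mul.
case: c => [|[|[|[|//]]]] /=; rewrite ?leq_min.
- move=> [/andP[le_ka le_kb] _] /andP[_ nA] /andP[eB nB].
  have dz := key _ _ le_kb eB.
  have k_gt0 : 0 < k.
    by case: k nB {le_ka le_kb nA eB dz} => //; rewrite subn0 dvdn_mull.
  split=> //; apply: contraNT nA => even_r.
  apply: (big _ _ (1 + (a - k))) dz _ _; last by lia.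
  by rewrite expnD dvdn_mul // expn1 dvdn2.
- move=> [/and3P[k_gt0 le_ka le_kb] _] /andP[eA _] /andP[_ /negP[]].
  apply: (big _ _ (b - k + 1)) (key _ _ le_ka eA) _ _; last by lia.
  exact: dvdn_mull.
- move=> [/andP[lt_ak le_kb] _] /andP[_ /negP nA] /andP[eB _]; case: nA.
  by apply: (big _ _ 0) (key _ _ le_kb eB) _ _; [exact: dvd1n | lia].
- move=> [/andP[lt_bk le_ka] _] /andP[eA _] /andP[_ /negP[]].
  by apply: (big _ _ 0) (key _ _ le_ka eA) _ _; [exact: dvd1n | lia].
Qed.

(** * Sorting indices by class *)

(** The positions holding values below c form an initial segment, whose length
    is then the number of such values. *)
Lemma sorting_perm (s : nat) (f : 'I_s -> nat) :
  exists sigma : {perm 'I_s}, forall (i : 'I_s) (c : nat),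
    (i < #|[set l | f l < c]|) = (f (sigma i) < c).
Proof.
pose leT := relpre f leq.
have srt : sorted leT (sort leT (enum 'I_s)).
  by apply: sort_sorted => i l; exact: leq_total.
have sz : size (sort leT (enum 'I_s)) == s by rewrite size_sort size_enum_ord.
have /tuple_permP[sigma e] : perm_eq (Tuple sz) (ord_tuple s).
  by rewrite perm_sort.
have mono (i l : 'I_s) : i <= l -> f (sigma i) <= f (sigma l).
  have nthE (h : 'I_s) : nth i (sort leT (enum 'I_s)) h = sigma h.
    rewrite -(tnth_nth i (Tuple sz)) [Tuple sz](val_inj e).
    by rewrite tnth_mktuple tnth_ord_tuple.
  move=> le_il; rewrite -!nthE; apply: (sorted_leq_nth _ _ i srt) => //=.
  - by move=> ? ? ?; exact: leq_trans.
  - by move=> h; exact: leqnn.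
  - by rewrite inE (eqP sz).
  - by rewrite inE (eqP sz).
exists sigma => i c.
have -> : #|[set l | f l < c]| = #|[set l | f (sigma l) < c]|.
  rewrite -(card_imset _ (@perm_inj _ sigma)); apply: eq_card => l.
  rewrite !inE; apply/idP/imsetP => [flc | [h]]; last by rewrite inE => ? ->.
  by exists ((sigma^-1)%g l); rewrite ?inE permKV.
have cards (P : pred nat) h : h <= s ->
    (forall l : 'I_s, P l = (l < h)) -> #|[set l : 'I_s | P l]| = h.
  move=> le_hs eP.
  have widen_inj : injective (widen_ord le_hs).
    by move=> g g' /(congr1 val)/= /val_inj.
  rewrite -[RHS]card_ord -(card_imset _ widen_inj).
  apply: eq_card => l; rewrite inE eP.
  apply/idP/imsetP => [lt_lh | [g _ ->]]; last exact: (ltn_ord g).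
  by exists (Ordinal lt_lh) => //; apply: val_inj.
have [lt_c | ge_c] := ltnP (f (sigma i)) c.
- rewrite -(cards (fun l => l < i.+1) i.+1) ?ltn_ord //.
  apply/subset_leq_card/fintype.subsetP => l; rewrite !inE ltnS => /mono le_f.
  exact: leq_ltn_trans le_f lt_c.
- apply/negbTE; rewrite -leqNgt -[leqRHS](cards (fun l => l < i) i) //;
    last exact: ltnW.
  apply/subset_leq_card/fintype.subsetP => l; rewrite !inE => lt_f.
  rewrite ltnNge; apply/negP => /mono le_f.
  by move: (leq_trans ge_c le_f); rewrite leqNgt lt_f.
Qed.

(** * Finite families of congruences *)

Section ChineseRemainder.
Variables (I : finType) (M : I -> nat).
Hypothesis coM : forall i l, i != l -> coprime (M i) (M l).

Lemma coprime_prod_others (r : seq I) i : i \notin r ->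
  coprime (M i) (\prod_(l <- r) M l).
Proof.
move=> nri; rewrite big_seq; elim/big_rec: _ => [|l w lr cw].
  exact: coprimen1.
by rewrite coprimeMr cw coM //; apply: contraNneq nri => ->.
Qed.

Lemma eqn_mod_prod (x y : nat) :
  (forall i, x = y %[mod M i]) -> x = y %[mod \prod_i M i].
Proof.
move=> exy; have := index_enum_uniq I.
elim: (index_enum I) => [_|i r IHr /andP[nri /IHr er]].
  by rewrite big_nil !modn1.
apply/eqP; rewrite big_cons chinese_remainder ?coprime_prod_others //.
by rewrite exy er !eqxx.
Qed.

Lemma chinese_family (w : I -> nat) : exists u, forall i, u = w i %[mod M i].
Proof.
have [u eu] : exists u, forall i, i \in index_enum I -> u = w i %[mod M i].
  have := index_enum_uniq I.
  elim: (index_enum I) => [_|i r IHr /= /andP[nri /IHr[u eu]]].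
    by exists 0.
  have co := coprime_prod_others nri.
  exists (chinese (M i) (\prod_(l <- r) M l) (w i) u) => l.
  rewrite inE => /predU1P[-> | lr]; first exact: chinese_modl.
  have dvd_l : M l %| \prod_(l <- r) M l by rewrite (big_rem l lr) dvdn_mulr.
  by rewrite -eu // -(modn_dvdm _ dvd_l) chinese_modr // modn_dvdm.
by exists u => i; apply: eu; rewrite mem_index_enum.
Qed.
End ChineseRemainder.

(** * Gluing the primes of n and m *)

Section Factorization.
Variables (I : finType) (q alpha : I -> nat).
Hypotheses (q_prime : forall i, prime (q i)) (q_inj : injective q).

Lemma coprime_prime_powers (a b : I -> nat) i l : i != l ->
  coprime (q i ^ a i) (q l ^ b l).
Proof.
move=> ne_il; apply: coprimeXl; apply: coprimeXr.
by rewrite prime_coprime // dvdn_prime2 // (inj_eq q_inj).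
Qed.

Lemma cofactorE i :
  (\prod_l q l ^ alpha l) %/ q i ^ alpha i = \prod_(l | l != i) q l ^ alpha l.
Proof. by rewrite (bigD1 i) //= mulKn // expn_gt0 prime_gt0. Qed.

Lemma coprime_cofactor i :
  coprime ((\prod_l q l ^ alpha l) %/ q i ^ alpha i) (q i).
Proof.
rewrite cofactorE; apply: (big_ind (fun w => coprime w (q i))) => //.
- exact: coprime1n.
- by move=> w v cw cv; rewrite coprimeMl cw.
- move=> l ne_li; have := @coprime_prime_powers alpha (fun=> 1) l i ne_li.
  by rewrite expn1.
Qed.

(** Every other term contains the factor (q i)^(alpha i). *)
Lemma mixed_sum_mod (c : I -> nat) i (n := \prod_l q l ^ alpha l) :
  \sum_l c l * (n %/ q l ^ alpha l)
    = c i * (n %/ q i ^ alpha i) %[mod q i ^ alpha i].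
Proof.
rewrite (bigD1 i) //= -modnDmr (_ : (\sum_(l | l != i) _) %% _ = 0) ?addn0 //.
apply/eqP/dvdn_sum => l ne_li; apply: dvdn_mull.
by rewrite /n cofactorE (bigD1 i) 1?eq_sym //= dvdn_mulr.
Qed.

(** How the element of order 2 is transferred to the prime 2, where the
    cofactor is odd. *)
Lemma order2_mixed_sum (c : I -> nat) i z (n := \prod_l q l ^ alpha l) :
  q i = 2 -> of_order2 n (z * \sum_l c l * (n %/ q l ^ alpha l)) ->
  of_order2 (2 ^ alpha i) (z * c i).
Proof.
move=> qi2; have := coprime_cofactor i; rewrite -/n qi2.
have dvd_i : 2 ^ alpha i %| n by rewrite /n (bigD1 i) //= qi2 dvdn_mulr.
set e := n %/ _ => co_e ord_n.
have n_split : n = 2 ^ alpha i * e by rewrite mulnC divnK.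
have co2e : coprime (2 ^ alpha i) e by rewrite coprimeXl // coprime_sym.
move: ord_n; rewrite {1}n_split => /of_order2_factor.
move=> /(_ co2e); rewrite -coprimen2 => /(_ co_e).
have eq_i := mixed_sum_mod c i; rewrite -/n qi2 -/e in eq_i.
rewrite (of_order2_mod z eq_i) mulnA of_order2_unit //.
by rewrite coprime_sym.
Qed.
End Factorization.

(** The local units are glued modulo (q i)^(alpha i + beta i + 1): the exponent
    is large enough for both entries, and it is positive, which makes u prime to
    q i even where both exponents vanish. *)
Lemma global_normal_form (I : finType) (q alpha beta : I -> nat) (x y : nat)
    (n := \prod_i q i ^ alpha i) (m := \prod_i q i ^ beta i) :
  (forall i, prime (q i)) -> injective q ->
  exists (u : nat) (c k r rho j : I -> nat),
    [/\ coprime u n /\ coprime u m,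
        forall i, local_ranges (q i) (alpha i) (beta i) (c i) (k i) (r i)
                               (rho i) (j i),
        \sum_i local_coefA (q i) (alpha i) (c i) (k i) (r i) (j i)
               * (n %/ q i ^ alpha i) = u * x %[mod n]
      & \sum_i local_coefB (q i) (beta i) (c i) (k i) (rho i) (j i)
               * (m %/ q i ^ beta i) = u * y %[mod m]].
Proof.
move=> q_prime q_inj.
have local i := local_normal_form (alpha i) (beta i) x y (q_prime i)
  (coprime_cofactor alpha q_prime q_inj i)
  (coprime_cofactor beta q_prime q_inj i).
have [w] := fin_all_exists local.
move=> /fin_all_exists[c /fin_all_exists[k /fin_all_exists[r]]].
move=> /fin_all_exists[rho /fin_all_exists[j loc]].
have coM := coprime_prime_powers q_prime q_inj.
have [u eu] := chinese_family
  (coM (fun i => (alpha i + beta i).+1) (fun i => (alpha i + beta i).+1)) w.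
have mod_u i d : d <= (alpha i + beta i).+1 -> u = w i %[mod q i ^ d].
  move=> le_d; have dvd_d := dvdn_exp2l (q i) le_d.
  by rewrite -(modn_dvdm u dvd_d) eu modn_dvdm.
have cou (e : I -> nat) : coprime u (\prod_i q i ^ e i).
  rewrite coprime_sym; apply: (big_ind (fun v => coprime v u)) => [|v v' cv cv'|i _].
  - exact: coprime1n.
  - by rewrite coprimeMl cv.
  - have [cwi _ _ _] := loc i; apply: coprimeXl; rewrite coprime_sym.
    by rewrite -coprime_modl -[q i]expn1 mod_u // expn1 coprime_modl.
exists u, c, k, r, rho, j; split; first by split; apply: cou.
- by move=> i; have [] := loc i.
- apply: (eqn_mod_prod (coM alpha alpha)) => i; rewrite mixed_sum_mod //.
  have [_ _ -> _] := loc i.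
  by rewrite -[in RHS]modnMml mod_u ?modnMml // leqW ?leq_addr.
- apply: (eqn_mod_prod (coM beta beta)) => i; rewrite mixed_sum_mod //.
  have [_ _ _ ->] := loc i.
  by rewrite -[in RHS]modnMml mod_u ?modnMml // leqW ?leq_addl.
Qed.

(** * The blocks of the two sums *)

(** Class number d occupies exactly the d-th of the four intervals that tile
    the index set. *)
Definition consecutive_blocks (s : nat) (c : 'I_s -> nat)
    (nu chi tau psi : nat) : Prop :=
  nu + chi + tau + psi = s /\
  forall i : 'I_s,
    [/\ (i < nu) = (c i == 0), (nu <= i < nu + chi) = (c i == 1),
        (nu + chi <= i < nu + chi + tau) = (c i == 2) &
        (nu + chi + tau <= i < nu + chi + tau + psi) = (c i == 3)].

Lemma block_decomposition (s : nat) (c : 'I_s -> nat) :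
  (forall i, c i < 4) ->
  exists (sigma : {perm 'I_s}) (nu chi tau psi : nat),
    consecutive_blocks (fun i => c (sigma i)) nu chi tau psi.
Proof.
move=> lt_c4; have [sigma sorted_c] := sorting_perm c.
pose N d := #|[set l | c l < d]|.
have N_mono d : N d <= N d.+1.
  by apply/subset_leq_card/fintype.subsetP => l; rewrite !inE => /ltnW.
have N4 : N 4 = s.
  rewrite -[RHS]card_ord; apply: eq_card => l.
  by rewrite inE lt_c4.
exists sigma, (N 1), (N 2 - N 1), (N 3 - N 2), (N 4 - N 3).
rewrite /consecutive_blocks !subnKC //; split=> // i.
rewrite ![N _ <= _]leqNgt !sorted_c; have := lt_c4 (sigma i).
by case: (c (sigma i)) => [|[|[|[|]]]].
Qed.

Lemma cyclicA_blocks (s : nat) (p a c : 'I_s -> nat) nu chi tau psi k r j n :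
  (forall i, c i < 4) -> consecutive_blocks c nu chi tau psi ->
  cyclicA p a nu chi tau psi k r j n =
  \sum_i local_coefA (p i) (a i) (c i) (k i) (r i) (j i) * (n %/ p i ^ a i).
Proof.
move=> lt_c4 [_ blk]; rewrite /cyclicA.
rewrite (big_mkcond (fun i : 'I_s => i < nu)).
rewrite (big_mkcond (fun i : 'I_s => nu <= i < nu + chi)).
rewrite (big_mkcond (fun i : 'I_s => nu + chi <= i < nu + chi + tau)).
rewrite (big_mkcond (fun i : 'I_s => _ <= i < nu + chi + tau + psi)).
rewrite -!big_split; apply: eq_bigr => i _ /=.
have [-> -> -> ->] := blk i; have := lt_c4 i.
by case: (c i) => [|[|[|[|]]]] //= _; rewrite ?addn0.
Qed.

Lemma cyclicB_blocks (s : nat) (p b c : 'I_s -> nat) nu chi tau psi k rho j m :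
  (forall i, c i < 4) -> consecutive_blocks c nu chi tau psi ->
  cyclicB p b nu chi tau psi k rho j m =
  \sum_i local_coefB (p i) (b i) (c i) (k i) (rho i) (j i) * (m %/ p i ^ b i).
Proof.
move=> lt_c4 [_ blk]; rewrite /cyclicB.
rewrite (big_mkcond (fun i : 'I_s => i < nu)).
rewrite (big_mkcond (fun i : 'I_s => nu <= i < nu + chi)).
rewrite (big_mkcond (fun i : 'I_s => nu + chi <= i < nu + chi + tau)).
rewrite (big_mkcond (fun i : 'I_s => _ <= i < nu + chi + tau + psi)).
rewrite -!big_split; apply: eq_bigr => i _ /=.
have [-> -> -> ->] := blk i; have := lt_c4 i.
by case: (c i) => [|[|[|[|]]]] //= _; rewrite ?addn0.
Qed.

Lemma local_ranges_lt4 p a b c k r rho j :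
  local_ranges p a b c k r rho j -> c < 4.
Proof. by case: c => [|[|[|[|]]]]. Qed.

(** Only the prime 2, at position t, carries constraints beyond the local
    ones. *)
Lemma param_ranges_blocks (s : nat) (p a b c k r rho j : 'I_s -> nat)
    (nu chi tau psi : nat) (t : 'I_s) :
  (forall i, local_ranges (p i) (a i) (b i) (c i) (k i) (r i) (rho i) (j i)) ->
  consecutive_blocks c nu chi tau psi ->
  p t = 2 -> c t = 0 -> 0 < k t -> odd (r t) ->
  param_ranges p a b nu chi tau psi k r rho j.
Proof.
move=> rg [sum_s blk] pt2 ct0 kt_gt0 odd_r.
have class i d : c i == d ->
    local_ranges (p i) (a i) (b i) d (k i) (r i) (rho i) (j i).
  by move=> /eqP<-.
split; first by rewrite sum_s.
- exists t; have [nuE _ _ _] := blk t.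
  have [le_k le_r] := class t 0 (introT eqP ct0).
  split; rewrite ?nuE ?ct0 ?kt_gt0 //.
    split; first by rewrite odd_gt0 // -pt2.
    by case=> l _ er; move: odd_r; rewrite er muln2 odd_double.
  by move=> i; have [-> _ _ _] := blk i => /class.
- by move=> i; have [_ -> _ _] := blk i => /class.
- by move=> i; have [_ _ -> _] := blk i => /class.
- by move=> i; have [_ _ _ ->] := blk i => /class.
Qed.

(** * Rotations by fractions of a turn *)

Section Rotations.
Local Open Scope classical_set_scope.
Local Open Scope ring_scope.

Definition turn (R : realType) (n : nat) (w : int) : 'M[R]_2 :=
  rotation_mx (2 * pi / n%:R * w%:~R).

Lemma rotation_mxD (R : realType) (t u : R) :
  rotation_mx (t + u) = rotation_mx t * rotation_mx u.
Proof.
apply/matrixP => i j; rewrite !mxE !big_ord_recl big_ord0 !mxE cosD sinD.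
by case: i => [[|[|?]] ?]; case: j => [[|[|?]] ?] //=; ring.
Qed.

Lemma rotation_mx0 (R : realType) : rotation_mx 0 = 1 :> 'M[R]_2.
Proof.
apply/matrixP => i j; rewrite !mxE cos0 sin0 oppr0.
by case: (i == j); rewrite ?if_same.
Qed.

Lemma turn0 (R : realType) n : turn R n 0 = 1.
Proof. by rewrite /turn mulr0 rotation_mx0. Qed.

Lemma turnD (R : realType) n w v : turn R n (w + v) = turn R n w * turn R n v.
Proof. by rewrite /turn intrD mulrDr rotation_mxD. Qed.

Lemma turn_order (R : realType) n : (0 < n)%N -> turn R n n%:Z = 1.
Proof.
move=> n_gt0; rewrite /turn divfK ?pnatr_eq0 -?lt0n //.
by apply/matrixP => i j; rewrite !mxE mulr_natl cos2pi sin2pi oppr0;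
  case: (i == j); rewrite ?if_same.
Qed.

(** Identifies integer powers, the negative ones included, without computing
    the inverse of a rotation or of a pair of rotations. *)
Lemma morphism_expz (T : unitRingType) (f : int -> T) :
  f 0 = 1 -> (forall z w, f (z + w) = f z * f w) -> forall z, f 1 ^ z = f z.
Proof.
move=> f0 fD.
have fn (k : nat) : f 1 ^+ k = f k%:Z.
  by elim: k => [|k IHk]; rewrite ?expr0 // exprS IHk -fD -intS.
case=> k; first exact: fn.
rewrite NegzE -exprz_inv /= -[_ ^ _]/(_ ^+ k.+1) exprVn fn.
have u_f : f k.+1%:Z \is a GRing.unit.
  by apply/unitrP; exists (f (- k.+1%:Z)); rewrite -!fD addNr subrr.
by apply: (mulrI u_f); rewrite divrr // -fD subrr.
Qed.

Lemma turn_expz (R : realType) n w z : turn R n w ^ z = turn R n (w * z).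
Proof.
rewrite -{1}[w]mulr1.
apply: (@morphism_expz _ (fun z => turn R n (w * z))) => [|v v'].
  by rewrite mulr0 turn0.
by rewrite mulrDr turnD.
Qed.

(** It suffices to treat a remainder 0 < r < n.  With t = pi r / n in ]0, pi[,
    cos (2 t) = 1 would give sin t = 0. *)
Lemma turn_eq1 (R : realType) n w : (0 < n)%N ->
  (turn R n w == 1) = (n%:Z %| w)%Z.
Proof.
move=> n_gt0; have n_neq0 : n%:Z != 0 by rewrite -lt0n.
have turn_mul v : turn R n (n%:Z * v) = 1.
  by rewrite -turn_expz turn_order // exp1rz.
apply/eqP/idP => [rw1 | /dvdzP[v ->]]; last by rewrite mulrC.
have [r [r_ge0 r_lt def_w]] :
    exists r, [/\ 0 <= r, r < n%:Z & w = n%:Z * (w %/ n%:Z)%Z + r].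
  exists (w %% n%:Z)%Z; split; first exact: modz_ge0.
    by rewrite ltz_pmod.
  by rewrite mulrC -divz_eq.
rewrite def_w rpredD ?dvdz_mulr //.
move: rw1; rewrite def_w turnD turn_mul mul1r => /matrixP/(_ 0 0).
rewrite !mxE /=.
have [-> _| r_neq0 cos1] := eqVneq r 0; first exact: dvdz0.
pose t : R := pi / n%:R * r%:~R.
have n_pos : 0 < n%:R :> R by rewrite ltr0n.
have t_gt0 : 0 < t.
  by rewrite !mulr_gt0 ?invr_gt0 ?pi_gt0 // ltr0z lt_neqAle eq_sym r_neq0.
have t_lt : t < pi.
  rewrite /t -mulrA gtr_pMr ?pi_gt0 // mulrC ltr_pdivrMr // mul1r.
  by rewrite -[n%:R]/(n%:Z%:~R) ltr_int.
have sin_gt0 : 0 < sin t by apply: sin_gt0_pi; rewrite t_gt0.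
have cos_sq : cos t ^+ 2 *+ 2 = 2.
  have -> : cos t ^+ 2 *+ 2 = cos (t *+ 2) + 1 by rewrite cos_mulr2n subrK.
  have -> : t *+ 2 = 2 * pi / n%:R * r%:~R.
    by rewrite -[LHS]mulr_natl !mulrA.
  by rewrite cos1.
have := exprn_gt0 2 sin_gt0.
by rewrite sin2cos2; lra.
Qed.

Lemma turn_eqmod (R : realType) n w v : (0 < n)%N ->
  (w = v %[mod n%:Z])%Z -> turn R n w = turn R n v.
Proof.
move=> n_gt0 /eqP; rewrite eqz_mod_dvd -(turn_eq1 R _ n_gt0) => /eqP e.
by rewrite -[w](subrK v) turnD e mul1r.
Qed.

(** The square of -I is I, and -I is not I in characteristic 0. *)
Lemma turn_eqN1 (R : realType) n w : (0 < n)%N ->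
  turn R n w = - 1%:M -> of_order2 n `|w|%N.
Proof.
move=> n_gt0 wN1; have nat_dvd v : (n %| `|v|)%N = (turn R n v == 1).
  by rewrite turn_eq1.
have n_two : (2 * `|w| = `|(w + w)%R|)%N by rewrite -mulr2n -mulr_natl abszM.
rewrite /of_order2 n_two !nat_dvd turnD wN1 mulrNN mulr1 eqxx /=.
apply/eqP => /matrixP/(_ 0 0)/eqP; rewrite !mxE /= eq_sym -subr_eq0 opprK.
by rewrite -[1 + 1]/(2%:R) pnatr_eq0.
Qed.

Lemma rotation_group_turn (R : realType) n (M : 'M[R]_2) :
  rotation_group n M -> exists x : nat, M = turn R n x.
Proof. by case=> x _ <-; exists x; rewrite /turn mulrAC. Qed.

Lemma pair_turn_expz (R : realType) n m x y z :
  ((turn R n x, turn R m y) : ('M[R]_2 * 'M[R]_2)%type) ^ z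
    = (turn R n (x * z), turn R m (y * z)).
Proof.
rewrite -{1}[x]mulr1 -{1}[y]mulr1.
apply: (@morphism_expz _
  (fun z => (turn R n (x * z), turn R m (y * z)) : ('M[R]_2 * 'M[R]_2)%type)).
  by rewrite !mulr0 !turn0.
by move=> z1 z2; rewrite !mulrDr !turnD.
Qed.

(** The parameter z becomes v z in one direction and u z in the other, where v
    is an inverse of u modulo nm. *)
Lemma same_multiples (R : realType) n m x y A B u : (0 < n)%N -> (0 < m)%N ->
  coprime u n -> coprime u m ->
  A = (u * x)%N %[mod n] -> B = (u * y)%N %[mod m] ->
  [set (turn R n (x%:Z * z), turn R m (y%:Z * z)) | z in [set: int]] =
  [set (turn R n (A%:Z * z), turn R m (B%:Z * z)) | z in [set: int]].
Proof.
move=> n_gt0 m_gt0 cun cum eA eB.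
have [||v _ uv] := @coprime_inverse (n * m) u.
- by rewrite muln_gt0 n_gt0.
- by rewrite coprimeMr cun.
have zmod d w w' : w = w' %[mod d] -> (w%:Z = w'%:Z %[mod d])%Z.
  by rewrite !modz_nat => ->.
have mod_scale d (w w' z : int) : (w = w' %[mod d] -> w * z = w' * z %[mod d])%Z.
  by move=> e; rewrite -modzMml e modzMml.
apply/seteqP; split=> _ [z _ <-].
- exists (v%:Z * z) => //.
  have gen (d w D : nat) : (0 < d)%N -> (d %| n * m)%N -> D = (u * w)%N %[mod d] ->
      turn R d (D%:Z * (v%:Z * z)) = turn R d (w%:Z * z).
    move=> d_gt0 dvd_d eD; apply: turn_eqmod => //; rewrite mulrA.
    apply: mod_scale; rewrite -PoszM; apply: zmod.
    rewrite -modnMml eD modnMml mulnAC -modnMml -(modn_dvdm (u * v) dvd_d) uv.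
    by rewrite modn_dvdm // modnMml mul1n.
  by rewrite (gen n x) ?dvdn_mulr // (gen m y) ?dvdn_mull.
- exists (u%:Z * z) => //.
  have gen (d w D : nat) : (0 < d)%N -> D = (u * w)%N %[mod d] ->
      turn R d (w%:Z * (u%:Z * z)) = turn R d (D%:Z * z).
    move=> d_gt0 eD; apply: turn_eqmod => //; rewrite mulrA.
    by apply: mod_scale; rewrite -PoszM; apply: zmod; rewrite eD mulnC.
  by rewrite (gen n x A) // (gen m y B).
Qed.
End Rotations.

(** * Cyclic subgroups containing (-I, -I) *)

Local Open Scope classical_set_scope.
Local Open Scope ring_scope.

Theorem theorem7 (R : realType) (n m : nat)
    (C : set ('M[R]_2 * 'M[R]_2)%type)
    (s : nat) (hs : (0 < s)%N) (q alpha beta : 'I_s -> nat) :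
  (0 < n)%N -> ~~ odd n -> (0 < m)%N -> ~~ odd m ->
  common_factorization n m hs q alpha beta ->
  is_subgroup C (@rotation_group R n `*` @rotation_group R m) ->
  is_cyclic C ->
  C (- 1%:M, - 1%:M) ->
  exists (nu chi tau psi : nat) (sigma : {perm 'I_s})
         (k r rho j : 'I_s -> nat),
    let p := fun i => q (sigma i) in
    let a := fun i => alpha (sigma i) in
    let b := fun i => beta (sigma i) in
    let A := cyclicA p a nu chi tau psi k r j n in
    let B := cyclicB p b nu chi tau psi k rho j m in
    param_ranges p a b nu chi tau psi k r rho j /\
    C = [set (rotation_mx (2 * pi / n%:R * A%:R * i%:~R),
              rotation_mx (2 * pi / m%:R * B%:R * i%:~R)) | i in [set: int]].
Proof.
move=> n_gt0 _ m_gt0 _ [q0 [q_odd q_inj] [alpha_gt0 beta_gt0] n_def m_def].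
move=> [sub_C _ _ _] [g Cg C_def] C_minus.
have q_prime i : prime (q i).
  by case: (eqVneq i (Ordinal hs)) => [-> | /q_odd[]//]; rewrite q0.
have [x [y g_def]] : exists x y : nat, g = (turn R n x, turn R m y).
  case: g Cg {C_def} => g1 g2 /sub_C[/=].
  move=> /rotation_group_turn[x ->] /rotation_group_turn[y ->].
  by exists x, y.
have {}C_def :
    C = [set (turn R n (x%:Z * z), turn R m (y%:Z * z)) | z in [set: int]].
  by rewrite C_def g_def; apply: eq_imagel => z _; exact: pair_turn_expz.
have [z [order_x order_y]] :
    exists z : nat, of_order2 n (z * x) /\ of_order2 m (z * y).
  move: C_minus; rewrite C_def => -[z _ [ex ey]]; exists `|z|%N.
  by split; [have := turn_eqN1 n_gt0 ex | have := turn_eqN1 m_gt0 ey];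
     rewrite abszM mulnC.
have [u [c [k [r [rho [j [[cun cum] rg eA eB]]]]]]] :=
  global_normal_form alpha beta x y q_prime q_inj.
rewrite -n_def in cun eA; rewrite -m_def in cum eB.
have order2_at N e w (coef : 'I_s -> nat) (i := Ordinal hs) :
    N = (\prod_i q i ^ e i)%N -> coprime u N ->
    (\sum_i coef i * (N %/ q i ^ e i) = u * w %[mod N])%N ->
    of_order2 N (z * w) -> of_order2 (2 ^ e i) (z * coef i).
  move=> N_def cuN eN; rewrite -(of_order2_unit _ cuN) -mulnA [(w * u)%N]mulnC.
  rewrite -(of_order2_mod z eN) N_def => ord_N.
  exact: (order2_mixed_sum q_prime q_inj q0 ord_N).
(* The element (-I, -I) enters here only, through order_x and order_y. *)
have [ct0 kt_gt0 odd_r] : [/\ c (Ordinal hs) = 0, 0 < k (Ordinal hs)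
   & odd (r (Ordinal hs))]%N.
  have := rg (Ordinal hs); rewrite q0 => rg0.
  apply: (order2_ranges (z := z) rg0).
  - by have := order2_at _ _ _ _ n_def cun eA order_x; rewrite q0.
  - by have := order2_at _ _ _ _ m_def cum eB order_y; rewrite q0.
have lt_c4 i : (c i < 4)%N := local_ranges_lt4 (rg i).
have [sigma [nu [chi [tau [psi blk]]]]] := block_decomposition lt_c4.
exists nu, chi, tau, psi, sigma, (fun i => k (sigma i)), (fun i => r (sigma i)),
  (fun i => rho (sigma i)), (fun i => j (sigma i)) => p a b A B.
split.
  apply: (param_ranges_blocks (t := (sigma^-1)%g (Ordinal hs))) blk _ _ _ _;
    rewrite /= ?permKV //; first by move=> i; exact: rg.
  by rewrite /p permKV.
have eA' : A = u * x %[mod n].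
  by rewrite -eA /A (cyclicA_blocks _ _ _ _ _ _ (fun i => lt_c4 (sigma i)) blk)
    [in RHS](reindex_inj (@perm_inj _ sigma)).
have eB' : B = u * y %[mod m].
  by rewrite -eB /B (cyclicB_blocks _ _ _ _ _ _ (fun i => lt_c4 (sigma i)) blk)
    [in RHS](reindex_inj (@perm_inj _ sigma)).
rewrite C_def (same_multiples R n_gt0 m_gt0 cun cum eA' eB').
by apply: eq_imagel => i _; rewrite /turn !intrM !mulrA.
Qed.
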